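(* Let $\Sigma$ be a nonempty subset of $\{\sigma_1,\sigma_\mu,\sigma_2\}$. Then for every identity $\mathbf u\approx\mathbf v$ the following conditions are equivalent: (i) $\mathbf u\approx\mathbf v$ is block-balanced and each $\Sigma$-bad pair of occurrences of two distinct non-linear variables in $\mathbf u$ is stable in $\mathbf u\approx\mathbf v$; (ii) $\mathbf u\approx\mathbf v$ can be derived from $\Sigma^\delta$ by swapping $\Sigma$-good adjacent pairs of occurrences (that is, there is a sequence of words $\mathbf u=\mathbf w_0,\mathbf w_1,\dots,\mathbf w_l=\mathbf v$ such that each $\mathbf w_{i+1}$ is obtained from $\mathbf w_i$ by an application of an identity of $\Sigma^\delta$ that swaps an adjacent $\Sigma$-good pair of occurrences in $\mathbf w_i$); (iii) $\mathbf u\approx\mathbf v$ is satisfied by the variety defined by $\Sigma^\delta$.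
   Context: Variables are elements of a countable alphabet $\mathfrak A$, words are elements of the free semigroup $\mathfrak A^+$; an identity is $\mathbf u\approx\mathbf v$ with $\mathbf u,\mathbf v$ words. Varieties are varieties of semigroups. $\sigma_\mu$ is $xt_1xyt_2y\approx xt_1yxt_2y$; $\sigma_1$ is $xyt_1xt_2y\approx yxt_1xt_2y$; $\sigma_2$ is $xt_1yt_2xy\approx xt_1yt_2yx$. For a set $\mathfrak X$ of variables, $\mathbf u(\mathfrak X)$ is the word obtained from $\mathbf u$ by deleting all occurrences of variables not in $\mathfrak X$; $\mathbf u(x,\mathfrak Y)=\mathbf u(\{x\}\cup\mathfrak Y)$. $\Sigma^\delta$ is the closure of $\Sigma$ under deleting variables: all identities $\mathbf u(\mathfrak X)\approx\mathbf v(\mathfrak X)$ with $(\mathbf u\approx\mathbf v)\in\Sigma$ and $\mathfrak X$ a set of variables. A variable is linear in a word if it occurs in it exactly once and non-linear if it occurs more than once; $\mathrm{Lin}(\mathbf u)$ is the set of linear variables of $\mathbf u$. An identity $\mathbf u\approx\mathbf v$ is block-balanced if $\mathbf u(x,\mathrm{Lin}(\mathbf u))=\mathbf v(x,\mathrm{Lin}(\mathbf u))$ for every variable $x$. Block-balanced identities are balanced (each variable occurs equally often on both sides). $\mathrm{OccSet}(\mathbf u)$ is the set of all occurrences of variables in $\mathbf u$, linearly ordered by position via $<_{\mathbf u}$; ${}_{i\mathbf u}x$ is the $i$-th occurrence of $x$ from the left in $\mathbf u$ and ${}_{last\,\mathbf u}x$ the last one. For a balanced identity $\mathbf u\approx\mathbf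 v$ identify ${}_{i\mathbf u}x$ with ${}_{i\mathbf v}x$; a pair $\{c,d\}\subseteq\mathrm{OccSet}(\mathbf u)$ is unstable in $\mathbf u\approx\mathbf v$ if $c<_{\mathbf u}d$ but $d<_{\mathbf v}c$ (or vice versa), and stable otherwise. $\Sigma$-bad and $\Sigma$-good pairs: let $\{c,d\}$ be a pair of occurrences in $\mathbf u$ of two distinct non-linear variables, $c$ an occurrence of one of them, $d$ an occurrence of the other (the roles of the two variables may be interchanged). The pair is - $\{\sigma_\mu,\sigma_2\}$-bad if both $c$ and $d$ are first occurrences of their variables; - $\{\sigma_1,\sigma_\mu\}$-bad if both $c$ and $d$ are last occurrences of their variables; - $\{\sigma_1,\sigma_2\}$-bad if one of $c,d$ is the first occurrence of its variable and the other is the last occurrence of its variable; - $\{\sigma_\mu\}$-bad if $c,d$ are both first occurrences or both last occurrences of their variables; - $\{\sigma_2\}$-bad if at least one of $c,d$ is the first occurrence of its variable; - $\{\sigma_1\}$-bad if at least one of $c,d$ is the last occurrence of its variable. No pair is $\{\sigma_1,\sigma_\mu,\sigma_2\}$-bad. A pair of occurrences of two distinct non-linear variables is $\Sigma$-good if it is not $\Sigma$-bad. *)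

(* Defs.v *)
From mathcomp Require Import all_boot finmap.

Set Implicit Arguments.
Unset Strict Implicit.
Unset Printing Implicit Defensive.

Local Open Scope fset_scope.

(* The countable alphabet is [nat].  [word] is the free monoid; elements of   *)
(* the free semigroup are the words different from [::], and nonemptiness is  *)
(* required wherever it matters.                                              *)
Definition word := seq nat.
Definition identity := (word * word)%type.

(* x = 0, y = 1, t1 = 2, t2 = 3 *)
Definition sigma_mu : identity := ([:: 0; 2; 0; 1; 3; 1], [:: 0; 2; 1; 0; 3; 1]).
Definition sigma_1 : identity := ([:: 0; 1; 2; 0; 3; 1], [:: 1; 0; 2; 0; 3; 1]).
Definition sigma_2 : identity := ([:: 0; 2; 1; 3; 0; 1], [:: 0; 2; 1; 3; 1; 0]).

Definition restrict (X : pred nat) (u : word) : word := [seq x <- u | X x].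

(* Deleting every variable does not yield a semigroup identity.               *)
Definition delta_closure (Sigma : {fset identity}) (e : identity) : Prop :=
  exists2 s, s \in Sigma &
  exists X : pred nat,
    [/\ e = (restrict X s.1, restrict X s.2), e.1 != [::] & e.2 != [::]].

Definition linear (u : word) (x : nat) : bool := count_mem x u == 1.
Definition nonlinear (u : word) (x : nat) : bool := 1 < count_mem x u.

Definition restrict_lin (x : nat) (X : pred nat) (u : word) : word :=
  restrict [pred z | (z == x) || X z] u.

Definition block_balanced (u v : word) : Prop :=
  forall x, restrict_lin x (linear u) u = restrict_lin x (linear u) v.

(* The pair (x, i) stands for the i-th occurrence of x from the left, counted *)
(* from 1.  The identification of the i-th occurrence of x in u with the i-th *)
(* occurrence of x in v is thus plain equality.                               *)
Definition occurrence := (nat * nat)%type.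

Definition occ_set (u : word) : pred occurrence :=
  [pred c | 1 <= c.2 <= count_mem c.1 u].

(* The position (from 0) of c in u; meaningless when c is not in occ_set u.   *)
Definition occ_pos (u : word) (c : occurrence) : nat :=
  nth (size u) [seq k <- iota 0 (size u) | nth 0 u k == c.1] c.2.-1.

Definition occ_lt (u : word) (c d : occurrence) : bool :=
  occ_pos u c < occ_pos u d.

Definition unstable (u v : word) (c d : occurrence) : bool :=
  occ_lt u c d && occ_lt v d c || occ_lt u d c && occ_lt v c d.
Definition stable (u v : word) (c d : occurrence) : bool := ~~ unstable u v c d.

Definition is_first (c : occurrence) : bool := c.2 == 1.
Definition is_last (u : word) (c : occurrence) : bool := c.2 == count_mem c.1 u.

Definition nonlinear_pair (u : word) (c d : occurrence) : bool :=
  [&& c \in occ_set u, d \in occ_set u, c.1 != d.1,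
      nonlinear u c.1 & nonlinear u d.1].

(* The last line is a dummy value: Sigma is always taken nonempty.            *)
Definition bad (Sigma : {fset identity}) (u : word) (c d : occurrence) : bool :=
  nonlinear_pair u c d &&
  match sigma_1 \in Sigma, sigma_mu \in Sigma, sigma_2 \in Sigma with
  | false, true, true => is_first c && is_first d
  | true, true, false => is_last u c && is_last u d
  | true, false, true =>
      is_first c && is_last u d || is_last u c && is_first d
  | false, true, false =>
      is_first c && is_first d || is_last u c && is_last u d
  | false, false, true => is_first c || is_first d
  | true, false, false => is_last u c || is_last u d
  | true, true, true => false
  | false, false, false => true
  end.

Definition good (Sigma : {fset identity}) (u : word) (c d : occurrence) : bool :=
  nonlinear_pair u c d && ~~ bad Sigma u c d.

Definition subst (theta : nat -> word) (u : word) : word :=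
  flatten [seq theta x | x <- u].

(* One application, in either direction, of the identity e.                   *)
Definition applies (e : identity) (w w' : word) : Prop :=
  exists (theta : nat -> word) (a b : word),
    (forall x, theta x != [::]) /\
    ((w = a ++ subst theta e.1 ++ b /\ w' = a ++ subst theta e.2 ++ b) \/
     (w = a ++ subst theta e.2 ++ b /\ w' = a ++ subst theta e.1 ++ b)).

(* c and d stand side by side in w, and w' is w with c and d exchanged.       *)
Definition swaps (c d : occurrence) (w w' : word) : Prop :=
  exists a b : word,
    [/\ w = a ++ [:: c.1; d.1] ++ b, w' = a ++ [:: d.1; c.1] ++ b,
        occ_pos w c = size a & occ_pos w d = (size a).+1].

Definition good_step (Sigma : {fset identity}) (w w' : word) : Prop :=
  (exists2 e, delta_closure Sigma e & applies e w w') /\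
  (exists c d, good Sigma w c d /\ swaps c d w w').

Definition good_derivable (Sigma : {fset identity}) (u v : word) : Prop :=
  exists (l : nat) (w : nat -> word),
    [/\ w 0 = u, w l = v & forall i, i < l -> good_step Sigma (w i) (w i.+1)].

(* The value of a word in a semigroup; None exactly on the empty word.        *)
Definition eval (T : Type) (op : SemiGroup.law T) (phi : nat -> T) (u : word) :
    option T :=
  if u is x :: s then Some (foldl op (phi x) [seq phi z | z <- s]) else None.

Definition satisfies (T : Type) (op : SemiGroup.law T) (e : identity) : Prop :=
  forall phi : nat -> T, eval op phi e.1 = eval op phi e.2.

Definition in_variety (E : identity -> Prop) (T : Type) (op : SemiGroup.law T) :
    Prop :=
  forall e, E e -> satisfies op e.

Definition variety_satisfies (E : identity -> Prop) (e : identity) : Prop :=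
  forall (T : Type) (op : SemiGroup.law T), in_variety E op -> satisfies op e.

(* Main.v *)
(* Everything is compared with the equivalence generated by exchanging two    *)
(* distinct adjacent letters x, y in a word a x y b, where sigma_mu allows it *)
(* if one letter occurs in a and the other in b, sigma_1 if both occur in b,  *)
(* sigma_2 if both occur in a.  This says exactly that the two adjacent       *)
(* occurrences form a good pair, so such an exchange respects condition (i).  *)
(* If (i) holds, the letters of v can be brought to the front of u one after  *)
(* the other, since each pair to be exchanged is inverted between u and v.    *)
(* Conversely, any substitution instance of an identity of Sigma^delta swaps  *)
(* two adjacent blocks, and can be carried out letter by letter; so the words *)
(* modulo the equivalence form a semigroup of the variety, which yields (i)   *)
(* from (iii).                                                                *)
Require Import Defs.
From HB Require Import structures.
From Stdlib Require Import Relation_Operators.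
From mathcomp Require Import all_boot finmap generic_quotient boolp.

Set Implicit Arguments.
Unset Strict Implicit.
Unset Printing Implicit Defensive.

(** The implications form a cycle around one relation, the equivalence [swap_equiv] generated by
    [swappable] exchanges of adjacent letters. An adjacent pair is good exactly when it is swappable
    ([good_adjacent]), and an exchange changes the relative order of no other pair; hence condition
    (i), with [v] fixed, is invariant under exchanges ([stable_bad_pairs_swap]).

    From (i) to (ii), [u] is sorted into [v] by adjacent transpositions ([stable_good_derivable]);
    each one inverts a pair on which [u] and [v] disagree, so the pair is good
    ([inverted_swappable]), and the exchange is an instance of an identity of the closure
    ([swappable_applies]). From (ii) to (iii) is soundness of equational reasoning. From (iii) to
    (i), words modulo [swap_equiv] form a semigroup of the variety ([swap_class_in_variety]), so [u]
    and [v] are exchange-equivalent, and the trivial case of [v] against itself is carried back to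
    [u]. *)

(** * Positions of occurrences and prefix counts *)

Lemma occ_pos_lt (a b : word) (x z j : nat) : z != x -> j > 0 ->
  (occ_pos (a ++ x :: b) (z, j) < size a) = (j <= count_mem z a).
Proof.
move=> zx; case: j => // j _; rewrite /occ_pos /=.
rewrite size_cat /= iotaD filter_cat add0n /= nth_cat size_filter.
have -> : filter (fun k => nth 0 (a ++ x :: b) k == z) (iota 0 (size a)) =
          filter (fun k => nth 0 a k == z) (iota 0 (size a)).
  apply: eq_in_filter => k; rewrite mem_iota /= add0n => lt_k.
  by rewrite nth_cat lt_k.
have cE : count (fun k => nth 0 (a ++ x :: b) k == z) (iota 0 (size a)) =
          count_mem z a.
  rewrite -[X in count_mem _ X](mkseq_nth 0) count_map.
  apply: eq_in_count => k; rewrite mem_iota /= add0n => lt_k.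
  by rewrite nth_cat lt_k.
rewrite cE; case: (ltnP j (count_mem z a)) => lt_j.
  rewrite -cE in lt_j.
  set s := filter _ _.
  have : nth (size a + (size b).+1) s j \in s.
    apply: mem_nth; rewrite size_filter; apply: leq_trans lt_j _.
    rewrite eq_leq //; apply: eq_in_count => k.
    by rewrite mem_iota /= add0n => lt_k; rewrite nth_cat lt_k.
  by rewrite mem_filter mem_iota add0n => /and3P[].
apply/negbTE; rewrite -leqNgt.
set s := if _ then _ else _.
(* If [z] has too few occurrences, [occ_pos] returns its default, the length of the word, which is
   not below [size a] either. *)
case: (ltnP (j - count_mem z a) (size s)) => lt_s; last first.
  by rewrite nth_default // leq_addr.
have : nth (size a + (size b).+1) s (j - count_mem z a) \in s by exact: mem_nth.
rewrite /s nth_cat ltnn subnn /= eq_sym (negbTE zx) mem_filter mem_iota.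
by case/and3P => _ /ltnW.
Qed.

Lemma occ_pos_cat (a b : word) (x : nat) :
  occ_pos (a ++ x :: b) (x, (count_mem x a).+1) = size a.
Proof.
rewrite /occ_pos /= size_cat /= iotaD filter_cat add0n /= nth_cat size_filter.
have -> : count (fun k => nth 0 (a ++ x :: b) k == x) (iota 0 (size a)) =
          count_mem x a.
  rewrite -[X in count_mem _ X](mkseq_nth 0) count_map.
  apply: eq_in_count => k; rewrite mem_iota /= add0n => lt_k.
  by rewrite nth_cat lt_k.
by rewrite ltnn subnn nth_cat ltnn subnn /= eqxx.
Qed.

Lemma occ_pos_neq (a b : word) (x z j : nat) : z != x -> j > 0 ->
  occ_pos (a ++ x :: b) (z, j) != size a.
Proof.
move=> zx; case: j => // j _; rewrite /occ_pos /=.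
set s := filter _ _.
case: (ltnP j (size s)) => lt_s.
  have := mem_nth (size (a ++ x :: b)) lt_s; rewrite mem_filter => /andP[+ _].
  apply: contraTneq => ->.
  by rewrite nth_cat ltnn subnn /= eq_sym.
by rewrite nth_default // size_cat /= -[X in _ != X]addn0 eqn_add2l.
Qed.

Lemma occ_lt_before (a b : word) (x z j : nat) : z != x -> j > 0 ->
  occ_lt (a ++ x :: b) (z, j) (x, (count_mem x a).+1) = (j <= count_mem z a).
Proof. by move=> zx j0; rewrite /occ_lt occ_pos_cat occ_pos_lt. Qed.

Lemma occ_lt_after (a b : word) (x z j : nat) : z != x -> j > 0 ->
  occ_lt (a ++ x :: b) (x, (count_mem x a).+1) (z, j) = (count_mem z a < j).
Proof.
move=> zx j0; rewrite /occ_lt occ_pos_cat ltn_neqAle eq_sym occ_pos_neq //=.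
by rewrite leqNgt occ_pos_lt // -ltnNge.
Qed.

Lemma split_occurrence (u : word) (x i : nat) : i < count_mem x u ->
  exists a b, u = a ++ x :: b /\ count_mem x a = i.
Proof.
elim: u i => //= y u IHu i; case: (eqVneq y x) => [-> | yx].
  case: i => [_ | i]; first by exists [::], u.
  rewrite add1n ltnS => /IHu[a [b [-> <-]]].
  by exists (x :: a), b; rewrite /= eqxx.
rewrite add0n => /IHu[a [b [-> <-]]].
by exists (y :: a), b; rewrite /= (negbTE yx).
Qed.

(** * Swappable letters and good adjacent pairs *)

(** Stated by membership rather than by counting, so that it visibly survives any enlargement of the
    context ([swappable_sub]). *)
Definition swappable (Sigma : {fset identity}) (a : word) (x y : nat)
    (b : word) : bool :=
  [|| (sigma_mu \in Sigma) && ((x \in a) && (y \in b) || (y \in a) && (x \in b)),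
      [&& sigma_1 \in Sigma, x \in b & y \in b] |
      [&& sigma_2 \in Sigma, x \in a & y \in a]].

Lemma swappableC Sigma a x y b :
  swappable Sigma a x y b = swappable Sigma a y x b.
Proof.
by rewrite /swappable orbC [_ && (y \in b)]andbC [(x \in a) && (y \in a)]andbC
  orbC [X in _ && X || _]orbC.
Qed.

Lemma swappable_sub Sigma a a' x y b b' :
  {subset a <= a'} -> {subset b <= b'} ->
  swappable Sigma a x y b -> swappable Sigma a' x y b'.
Proof.
move=> sa sb; rewrite /swappable.
case/or3P => [/andP[-> /orP[] /andP[/sa-> /sb->]] | /and3P[-> /sb-> /sb->]
  | /and3P[-> /sa-> /sa->]]; by rewrite ?orbT.
Qed.

(** The occurrence of [x] just after [a] is first iff [x] is absent from [a], last iff [x] is absent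
    from [b], and [x] is non-linear iff it lies in one of them; likewise for [y]. What remains is a
    finite check on which counts vanish and which identities are in [Sigma]. *)
Lemma good_adjacent Sigma a x y b :
  good Sigma (a ++ [:: x; y] ++ b)
    (x, (count_mem x a).+1) (y, (count_mem y a).+1) =
  (x != y) && swappable Sigma a x y b.
Proof.
have eq_addr m n : (m == m + n) = (n == 0) by rewrite -[X in X == _]addn0 eqn_add2l.
rewrite /good /bad /nonlinear_pair /nonlinear /is_first /is_last /swappable.
move: (sigma_1 \in Sigma) (sigma_mu \in Sigma) (sigma_2 \in Sigma) => s1 sm s2.
rewrite !inE /= !count_cat /=; case: (eqVneq x y) => [|xy].
  by rewrite /= !andbF.
rewrite !eqxx /= !add0n !add1n !addnS !ltnS !eqSS !leq_addr !eq_addr.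
rewrite -!has_pred1 !has_count.
case: (count_mem x a) (count_mem x b) => [|xa] [|xb];
case: (count_mem y a) (count_mem y b) => [|ya] [|yb];
by case: s1 sm s2 => [] [] [].
Qed.

(** * Invariance of condition (i) under exchanges *)

Definition swap_step (Sigma : {fset identity}) (u w : word) : Prop :=
  exists a x y b, [/\ x != y, swappable Sigma a x y b,
    u = a ++ [:: x; y] ++ b & w = a ++ [:: y; x] ++ b].

Definition stable_bad_pairs (Sigma : {fset identity}) (u v : word) : Prop :=
  forall c d, nonlinear_pair u c d -> bad Sigma u c d -> stable u v c d.

Lemma unstable_prefix (v p p' q q' : word) (x i z j : nat) :
    j > 0 -> z != x -> count_mem x p = i -> count_mem x p' = i ->
    (j <= count_mem z p) = (j <= count_mem z p') ->
  unstable (p ++ x :: q) v (x, i.+1) (z, j) =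
  unstable (p' ++ x :: q') v (x, i.+1) (z, j).
Proof.
move=> j0 zx cp cp' E; rewrite /unstable.
have -> : occ_lt (p ++ x :: q) (z, j) (x, i.+1) =
          occ_lt (p' ++ x :: q') (z, j) (x, i.+1).
  by rewrite -{1}cp -cp' !occ_lt_before.
suff -> : occ_lt (p ++ x :: q) (x, i.+1) (z, j) =
          occ_lt (p' ++ x :: q') (x, i.+1) (z, j) by [].
by rewrite -{1}cp -cp' !occ_lt_after // !ltnNge E.
Qed.

(** The order of [c] and [d] is read off from the prefix before [c]. The cases are whether [c] lies
    in [a], in [b], or is one of the two exchanged letters. *)
Lemma unstable_swap (v a b : word) (x y : nat) (c d : occurrence) :
    x != y -> nonlinear_pair (a ++ [:: x; y] ++ b) c d ->
    (c, d) != ((x, (count_mem x a).+1), (y, (count_mem y a).+1)) ->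
    (d, c) != ((x, (count_mem x a).+1), (y, (count_mem y a).+1)) ->
  unstable (a ++ [:: x; y] ++ b) v c d = unstable (a ++ [:: y; x] ++ b) v c d.
Proof.
case: c d => [p [|i]] [q j] xy /and5P[/andP[//= _ ci] /andP[/= j0 _] pq _ _].
rewrite eq_sym in pq.
have pE k : count_mem p (a ++ k) = count_mem p a + count_mem p k.
  exact: count_cat.
move=> cd dc; case: (ltnP i (count_mem p a)) => [|ia].
  case/split_occurrence => a1 [a2 [-> ca]].
  by rewrite -!catA /=; apply: unstable_prefix.
case: (leqP (count_mem p (a ++ [:: x; y])) i) => [ib|].
  have : i - count_mem p (a ++ [:: x; y]) < count_mem p b.
    by rewrite ltn_subLR // -count_cat -catA.
  case/split_occurrence => b1 [b2 [-> cb]].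
  have cE : count_mem p (a ++ [:: x; y]) + count_mem p b1 = i.
    by rewrite cb subnKC.
  have catE r : a ++ r ++ b1 ++ p :: b2 = ((a ++ r) ++ b1) ++ p :: b2.
    by rewrite !catA.
  rewrite (catE [:: x; y]) (catE [:: y; x]).
  apply: unstable_prefix => //.
  - by rewrite count_cat.
  - by rewrite -cE !count_cat /= [(y == p) + (_ + _)]addnCA.
  - by rewrite !count_cat /= [(y == q) + (_ + _)]addnCA.
rewrite pE /= addn0 => ixy.
case: (eqVneq p x) => [px | npx].
  subst p; have iE : i = count_mem x a.
    apply/eqP; rewrite eqn_leq ia andbT.
    by move: ixy; rewrite eqxx [y == x]eq_sym (negbTE xy) addn0 addn1 ltnS.
  have -> : a ++ [:: y; x] ++ b = (a ++ [:: y]) ++ x :: b by rewrite -catA.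
  rewrite /=; apply: unstable_prefix; rewrite ?iE //=.
    by rewrite count_cat /= eq_sym (negbTE xy) !addn0.
  (* The prefix before [c] gains one [y], which matters only for the index [j] of the exchanged [y]
     itself; that pair is excluded. *)
  rewrite count_cat /= addn0; case: (eqVneq y q) => [yq|]; last by rewrite addn0.
  subst q; move: cd; rewrite iE !xpair_eqE !eqxx /= => cd.
  by rewrite addn1 [RHS]leq_eqVlt (negbTE cd).
have yp : y = p.
  apply/eqP; apply: contraTT (leq_ltn_trans ia ixy) => yp.
  by rewrite eq_sym (negbTE npx) (negbTE yp) !addn0 ltnn.
subst p; have iE : i = count_mem y a.
  apply/eqP; rewrite eqn_leq ia andbT.
  by move: ixy; rewrite eqxx (negbTE xy) add0n addn1 ltnS.
have -> : a ++ [:: x; y] ++ b = (a ++ [:: x]) ++ y :: b by rewrite -catA.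
rewrite /=; apply: unstable_prefix; rewrite ?iE //=.
  by rewrite count_cat /= (negbTE xy) !addn0.
rewrite count_cat /= addn0; case: (eqVneq x q) => [xq|]; last by rewrite addn0.
subst q; move: dc; rewrite iE !xpair_eqE !eqxx /= andbT => dc.
by rewrite addn1 [LHS]leq_eqVlt (negbTE dc).
Qed.

Lemma bad_pairC Sigma u c d : bad Sigma u c d = bad Sigma u d c.
Proof.
rewrite /bad /nonlinear_pair eq_sym.
case: (c \in _) (d \in _) (nonlinear u c.1) (nonlinear u d.1) => [] [] [] [];
  rewrite ?andbF //=; congr (_ && _).
by do 3?case: ifP => _; rewrite // ?(andbC (is_first c)) ?(andbC (is_last u c))
  ?(orbC (is_first c)) ?(orbC (is_last u c)) // orbC.
Qed.

Lemma stable_bad_pairs_swap Sigma u w v :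
  swap_step Sigma u w -> block_balanced w v /\ stable_bad_pairs Sigma w v ->
  block_balanced u v /\ stable_bad_pairs Sigma u v.
Proof.
move=> [a [x [y [b [xy sw uE wE]]]]] [bal stab].
have count_uw z : count_mem z u = count_mem z w.
  by rewrite uE wE !count_cat /= [(x == z) + (_ + _)]addnCA.
have lin_uw : linear u =1 linear w by move=> z; rewrite /linear count_uw.
have nlp_uw c d : nonlinear_pair u c d = nonlinear_pair w c d.
  by rewrite /nonlinear_pair /nonlinear !inE !count_uw.
have gxy := good_adjacent Sigma a x y b; rewrite -uE xy sw /= in gxy.
have nlxy : nonlinear_pair u (x, (count_mem x a).+1) (y, (count_mem y a).+1).
  by case/andP: gxy.
split=> [z | c d nl_cd bad_cd].
  have [lx ly] : linear u x = false /\ linear u y = false.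
    case/and5P: nlxy => _ _ _; rewrite /nonlinear /linear /=.
    by case: (count_mem x u) (count_mem y u) => [|[|m]] // [|[|n]].
  transitivity (restrict_lin z (linear w) w); last first.
    by rewrite bal; apply: eq_filter => k /=; rewrite lin_uw.
  transitivity (restrict_lin z (linear u) w); last first.
    by apply: eq_filter => k /=; rewrite lin_uw.
  move: lx ly; rewrite /restrict_lin; set L := linear u => lx ly.
  rewrite /restrict uE wE !filter_cat /= lx ly !orbF.
  case: (eqVneq x z) => // xz; case: (eqVneq y z) => // yz.
  by rewrite xz yz eqxx in xy.
have bad_w : bad Sigma w c d.
  by move: bad_cd; rewrite /bad nlp_uw /is_last !count_uw.
have := stab c d; rewrite -nlp_uw => /(_ nl_cd bad_w).
(* The exchanged pair is good, so a bad pair differs from it and keeps its order. *)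
have ncd c' d' : bad Sigma u c' d' ->
    (c', d') != ((x, (count_mem x a).+1), (y, (count_mem y a).+1)).
  move=> bad'; apply: contraTneq gxy => -[<- <-].
  by rewrite /good bad' andbF.
rewrite /stable uE (unstable_swap v xy) -?wE -?uE //; first exact: ncd.
by apply: ncd; rewrite bad_pairC.
Qed.

(** * The exchange equivalence and substitution instances *)

Definition swap_equiv (Sigma : {fset identity}) : word -> word -> Prop :=
  clos_refl_trans word (swap_step Sigma).

Lemma swap_step_sym Sigma u w : swap_step Sigma u w -> swap_step Sigma w u.
Proof.
move=> [a [x [y [b [xy sw -> ->]]]]]; exists a, y, x, b.
by rewrite eq_sym swappableC.
Qed.

Lemma swap_equiv_sym Sigma u w : swap_equiv Sigma u w -> swap_equiv Sigma w u.
Proof.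
elim=> [x y /swap_step_sym|x|x y z _ yx _ zy]; first exact: rt_step.
  exact: rt_refl.
exact: rt_trans zy yx.
Qed.

Lemma swap_equiv_cat Sigma a b u w :
  swap_equiv Sigma u w -> swap_equiv Sigma (a ++ u ++ b) (a ++ w ++ b).
Proof.
elim=> [_ _ [p [x [y [q [xy sw -> ->]]]]]|x|x y z _ + _]; last exact: rt_trans.
  apply: rt_step; exists (a ++ p), x, y, (q ++ b); rewrite -!catA; split=> //.
  by apply: swappable_sub sw => z; rewrite mem_cat => ->; rewrite ?orbT.
exact: rt_refl.
Qed.

Lemma swap_equiv_stable Sigma u w v :
  swap_equiv Sigma u w -> block_balanced w v /\ stable_bad_pairs Sigma w v ->
  block_balanced u v /\ stable_bad_pairs Sigma u v.
Proof.
elim=> [x y|//|x y z _ IHxy _ IHyz /IHyz/IHxy//].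
exact: stable_bad_pairs_swap.
Qed.

Lemma swap_equiv_letter Sigma A X y B :
    {in X, forall x, x != y -> swappable Sigma A x y B} ->
  swap_equiv Sigma (A ++ X ++ y :: B) (A ++ y :: X ++ B).
Proof.
elim: X A => [|x X IHX] A swX /=; first exact: rt_refl.
apply: (@rt_trans _ _ _ (A ++ [:: x; y] ++ (X ++ B))).
  have := IHX (A ++ [:: x]); rewrite -!catA /=; apply=> z zX zy.
  apply: swappable_sub (swX z _ zy) => //; last by rewrite inE zX orbT.
  by move=> k; rewrite mem_cat => ->.
case: (eqVneq x y) => [->|xy]; first exact: rt_refl.
apply: rt_step; exists A, x, y, (X ++ B); split=> //.
apply: swappable_sub (swX x (mem_head _ _) xy) => // k.
by rewrite mem_cat orbC => ->.
Qed.

Lemma swap_equiv_block Sigma A X Y B :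
    {in X & Y, forall x y, x != y -> swappable Sigma A x y B} ->
  swap_equiv Sigma (A ++ X ++ Y ++ B) (A ++ Y ++ X ++ B).
Proof.
elim: Y A => [|y Y IHY] A swXY /=; first exact: rt_refl.
apply: (@rt_trans _ _ _ (A ++ y :: X ++ (Y ++ B))).
  apply: swap_equiv_letter => x xX xy.
  apply: swappable_sub (swXY x y xX (mem_head _ _) xy) => // k.
  by rewrite mem_cat orbC => ->.
have := IHY (A ++ [:: y]); rewrite -!catA /=; apply=> x z xX zY xz.
apply: swappable_sub (swXY x z xX _ xz) => //; last by rewrite inE zY orbT.
by move=> k; rewrite mem_cat => ->.
Qed.

(** Each identity exchanges the adjacent blocks [theta 0] and [theta 1], and the other copies of
    these blocks supply the occurrences that make their letters swappable. Empty images are allowed,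
    which accounts for deleted variables ([subst_restrict]). *)
Lemma swap_equiv_subst (Sigma : {fset identity}) (theta : nat -> word)
    (s : identity) :
    (Sigma `<=` [fset sigma_1; sigma_mu; sigma_2])%fset -> s \in Sigma ->
  swap_equiv Sigma (subst theta s.1) (subst theta s.2).
Proof.
move=> /fsubsetP sub sS; have := sub s sS.
rewrite !inE -orbA => /or3P[] /eqP sE; rewrite sE in sS *;
  rewrite /subst /= !cats0.
- apply: (@swap_equiv_block _ [::]) => x y xX yY _.
  by rewrite /swappable sS !mem_cat xX yY !orbT.
- have := @swap_equiv_block Sigma (theta 0 ++ theta 2) (theta 0) (theta 1)
    (theta 3 ++ theta 1); rewrite -!catA; apply=> x y xX yY _.
  by rewrite /swappable sS !mem_cat xX yY !orbT.
- have := @swap_equiv_block Sigma (theta 0 ++ theta 2 ++ theta 1 ++ theta 3)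
    (theta 0) (theta 1) [::]; rewrite -!catA !cats0; apply=> x y xX yY _.
  by rewrite /swappable sS !mem_cat xX yY !orbT.
Qed.

Lemma subst_restrict (theta : nat -> word) (X : pred nat) (u : word) :
  subst theta (restrict X u) = subst (fun z => if X z then theta z else [::]) u.
Proof.
by elim: u => //= x u; rewrite /subst /=; case: (X x) => /= ->.
Qed.

(** * Evaluation in semigroups and soundness *)

Lemma eval_cons (T : Type) (op : SemiGroup.law T) (phi : nat -> T) x u :
  eval op phi (x :: u) =
  Some (if eval op phi u is Some t then op (phi x) t else phi x).
Proof.
case: u => //= y u; congr Some.
by elim: u (phi y) => //= z u IHu t; rewrite -SemiGroup.opA -IHu.
Qed.

Lemma eval_cat (T : Type) (op : SemiGroup.law T) (phi : nat -> T) u v :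
  eval op phi (u ++ v) =
  match eval op phi u, eval op phi v with
  | Some s, Some t => Some (op s t)
  | None, t => t
  | s, None => s
  end.
Proof.
elim: u => [|x u IHu]; first by case: (eval op phi v).
rewrite cat_cons !eval_cons IHu.
by case: (eval op phi u) (eval op phi v) => [s|] [t|] //; rewrite SemiGroup.opA.
Qed.

Lemma eval_subst (T : Type) (op : SemiGroup.law T) (phi : nat -> T)
    (theta : nat -> word) (u : word) : (forall x, theta x != [::]) ->
  eval op phi (subst theta u) =
  eval op (fun x => odflt (phi 0) (eval op phi (theta x))) u.
Proof.
move=> theta0; elim: u => // x u IHu.
rewrite eval_cons -IHu /subst /= eval_cat -/(subst theta u).
by case: (theta x) (theta0 x) => // y s _; case: (eval op phi (subst theta u)).
Qed.

Lemma satisfies_applies (T : Type) (op : SemiGroup.law T) (e : identity) w w' :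
  satisfies op e -> applies e w w' -> satisfies op (w, w').
Proof.
move=> sat [theta [a [b [theta0 W]]]] phi /=.
have E : eval op phi (subst theta e.1) = eval op phi (subst theta e.2).
  by rewrite !eval_subst // sat.
by case: W => -[-> ->]; rewrite !eval_cat E.
Qed.

Lemma good_derivable_sound Sigma u v :
  good_derivable Sigma u v -> variety_satisfies (delta_closure Sigma) (u, v).
Proof.
move=> [l [w [<- <- steps]]] T op opV phi /=.
elim: l steps => // l IHl steps; rewrite IHl => [|i /ltnW]; last exact: steps.
have [[e eS ew] _] := steps l (ltnSn l).
exact: satisfies_applies (opV e eS) ew phi.
Qed.

(** * Exchanges as applications of identities *)

Lemma good_derivable_cons Sigma u w v :
  good_step Sigma u w -> good_derivable Sigma w v -> good_derivable Sigma u v.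
Proof.
move=> uw [l [f [f0 fl steps]]].
exists l.+1, (fun i => if i is i'.+1 then f i' else u); split=> // -[|i] /=.
  by rewrite f0.
exact: steps.
Qed.

(** An erasing substitution into [s] is a non-erasing one into the identity obtained by deleting the
    erased variables. *)
Lemma applies_delta (Sigma : {fset identity}) (s : identity)
    (theta : nat -> word) (a b : word) :
    s \in Sigma -> subst theta s.1 != [::] -> subst theta s.2 != [::] ->
  exists2 e, delta_closure Sigma e &
    applies e (a ++ subst theta s.1 ++ b) (a ++ subst theta s.2 ++ b).
Proof.
move=> sS n1 n2; pose X z := theta z != [::].
(* The value [[:: 0]] on deleted variables is arbitrary; it only keeps [theta'] non-erasing. *)
pose theta' z := if X z then theta z else [:: 0].
have theta'E u : subst theta' (restrict X u) = subst theta u.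
  rewrite subst_restrict; congr flatten; apply: eq_map => z.
  by rewrite /theta' /X; case: eqP.
have neq0 u : subst theta u != [::] -> restrict X u != [::].
  by rewrite -theta'E; apply: contraNneq => ->.
exists (restrict X s.1, restrict X s.2).
  by exists s => //; exists X; split; rewrite //= neq0.
exists theta', a, b; split; last by left; rewrite !theta'E.
by move=> z; rewrite /theta' /X; case: (eqVneq (theta z) [::]).
Qed.

Lemma applies_sym e w w' : applies e w w' -> applies e w' w.
Proof.
move=> [theta [a [b [theta0 W]]]]; exists theta, a, b; split=> //.
by case: W => -[-> ->]; [right | left]; split.
Qed.

(** The words separating the required occurrences, possibly empty, are the images of the linear
    variables. The arrangement of the other occurrences of [x] and [y] decides in which direction
    the identity is read. *)
Lemma swappable_applies Sigma a x y b : x != y -> swappable Sigma a x y b ->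
  exists2 e, delta_closure Sigma e &
    applies e (a ++ [:: x; y] ++ b) (a ++ [:: y; x] ++ b).
Proof.
pose th x y (t1 t2 : word) i :=
  match i with 0 => [:: x] | 1 => [:: y] | 2 => t1 | _ => t2 end.
have fwd s p q t1 t2 a' b' sS :=
  @applies_delta Sigma s (th p q t1 t2) a' b' sS.
have bwd s p q t1 t2 a' b' (sS : s \in Sigma)
    (n1 : subst (th p q t1 t2) s.1 != [::])
    (n2 : subst (th p q t1 t2) s.2 != [::]) : exists2 e, delta_closure Sigma e &
    applies e (a' ++ subst (th p q t1 t2) s.2 ++ b')
      (a' ++ subst (th p q t1 t2) s.1 ++ b').
  by have [e eS /applies_sym eA] := fwd s p q t1 t2 a' b' sS n1 n2; exists e.
move=> xy; case/or3P => [/andP[sS /orP[]] | /and3P[sS + yb] | /and3P[sS + ya]].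
- case/andP => /splitPr[a1 a2] /splitPr[b1 b2].
  have := fwd _ x y a2 b1 a1 b2 sS isT isT.
  by rewrite /subst /= -!catA /= -!catA.
- case/andP => /splitPr[a1 a2] /splitPr[b1 b2].
  have := bwd _ y x a2 b1 a1 b2 sS isT isT.
  by rewrite /subst /= -!catA /= -!catA.
- move=> xb; case/splitPr: xb yb => b1 b2.
  rewrite mem_cat inE eq_sym (negbTE xy) /= => /orP[] /splitPr[b3 b4].
    have := bwd _ y x b3 b4 a b2 sS isT isT.
    by rewrite /subst /= -!catA /= -!catA.
  have := fwd _ x y b1 b3 a b4 sS isT isT.
  by rewrite /subst /= -!catA /= -!catA.
- move=> xa; case/splitPr: xa ya => a1 a2.
  rewrite mem_cat inE eq_sym (negbTE xy) /= => /orP[] /splitPr[a3 a4].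
    have := bwd _ y x a4 a2 a3 b sS isT isT.
    by rewrite /subst /= -!catA /= -!catA.
  have := fwd _ x y a3 a4 a1 b sS isT isT.
  by rewrite /subst /= -!catA /= -!catA.
Qed.

Lemma swappable_good_step Sigma a x y b : x != y -> swappable Sigma a x y b ->
  good_step Sigma (a ++ [:: x; y] ++ b) (a ++ [:: y; x] ++ b).
Proof.
move=> xy sw; split; first exact: swappable_applies.
exists (x, (count_mem x a).+1), (y, (count_mem y a).+1).
rewrite good_adjacent xy sw; split=> //; exists a, b; split=> //.
  exact: occ_pos_cat.
have -> : a ++ [:: x; y] ++ b = (a ++ [:: x]) ++ y :: b by rewrite -catA.
have := occ_pos_cat (a ++ [:: x]) b y.
by rewrite count_cat /= (negbTE xy) !addn0 size_cat addn1.
Qed.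

(** * Sorting one word into the other *)

Lemma block_balanced_count u v z :
  block_balanced u v -> count_mem z u = count_mem z v.
Proof.
have count_restrict w : count_mem z (restrict_lin z (linear u) w) = count_mem z w.
  rewrite count_filter; apply: eq_count => k /=.
  by case: eqP.
by move=> /(_ z) bal; rewrite -count_restrict bal count_restrict.
Qed.

(* The pair (z, x) adjacent in the first word is inverted in the second one,  *)
(* so it is neither bad nor separated by a linear letter.                     *)
Lemma inverted_swappable Sigma a p z x b v :
    block_balanced (a ++ p ++ [:: z; x] ++ b) (a ++ x :: v) ->
    stable_bad_pairs Sigma (a ++ p ++ [:: z; x] ++ b) (a ++ x :: v) ->
    x \notin p -> z != x ->
  swappable Sigma (a ++ p) z x b.
Proof.
set u := a ++ p ++ _ => bal stab xp zx.
(* If [z] and [x] both survived the restriction to [t] and the linear letters, then after the common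
   prefix one side would start with [x] and the other with [z] or a letter of [p]. Taking [t] to be
   [x], then [z], makes [z], then [x], non-linear. *)
have nonlin_pass t : ~~ ((z == t) || linear u z) || ~~ ((x == t) || linear u x).
  rewrite -negb_and; apply/negP => /andP[zt xt].
  have /eqP := bal t; rewrite /restrict_lin; move: zt xt.
  set L := linear u => zt xt; rewrite /restrict /u !filter_cat /= zt xt.
  rewrite eqseq_cat // eqxx /=; set q := filter _ p => /eqP.
  have : x \notin q by rewrite mem_filter (negbTE xp) andbF.
  case: q => [|k q] /= xq [E _]; first by rewrite E eqxx in zx.
  by rewrite E mem_head in xq.
have uE : u = (a ++ p) ++ [:: z; x] ++ b by rewrite /u -catA.
have count_u t : 0 < count_mem t [:: z; x] -> ~~ linear u t -> nonlinear u t.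
  move=> t0 t1; rewrite /nonlinear ltn_neqAle [1 == _]eq_sym t1 /=.
  by rewrite uE count_cat (count_cat _ [:: z; x]) addnCA ltn_addr.
have zE : nonlinear u z.
  apply: count_u; first by rewrite /= eqxx.
  by have := nonlin_pass x; rewrite eqxx orbF; apply: contra => ->; rewrite orbT.
have xE : nonlinear u x.
  apply: count_u; first by rewrite /= eqxx addnCA.
  by have := nonlin_pass z; rewrite eqxx; apply: contra => ->; rewrite orbT.
pose c := (z, (count_mem z (a ++ p)).+1); pose d := (x, (count_mem x (a ++ p)).+1).
have nl : nonlinear_pair u c d.
  rewrite /nonlinear_pair !inE /= zE xE zx uE !count_cat /= !eqxx.
  by rewrite !add1n !addnS !ltnS !leq_addr.
suff gcd : good Sigma u c d.
  by move: gcd; rewrite uE good_adjacent zx.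
rewrite /good nl; apply/negP => /(stab _ _ nl)/negP; apply.
rewrite /unstable uE /= occ_lt_after // 1?eq_sym //.
have xp0 : count_mem x p = 0 by apply/count_memPn.
rewrite /c /d !count_cat xp0 addn0 /= ltnSn occ_lt_after //.
by rewrite ltnS leq_addr.
Qed.

(** The common prefix [a] grows along [v]: the first [x] of the remainder of [u] moves left, past
    the letters of [p] one at a time. *)
Lemma stable_good_derivable Sigma a u v :
    block_balanced (a ++ u) (a ++ v) ->
    stable_bad_pairs Sigma (a ++ u) (a ++ v) ->
  good_derivable Sigma (a ++ u) (a ++ v).
Proof.
elim: v a u => [|x v IHv] a u bal stab.
  have u0 : u = [::].
    case: u bal {stab} => // z u /(@block_balanced_count _ _ z) /eqP.
    by rewrite !count_cat /= eqxx eqn_add2l.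
  by rewrite u0; exists 0, (fun=> a ++ [::]).
have /split_occurrence[p [b [uE p0]]] : 0 < count_mem x u.
  have /eqP := block_balanced_count x bal.
  by rewrite !count_cat eqn_add2l => /eqP ->; rewrite /= eqxx.
rewrite {}uE in bal stab *; have {p0} : x \notin p by apply/count_memPn.
elim/last_ind: p b bal stab => [|p z IHp] b bal stab xp.
  by have := IHv (a ++ [:: x]) b; rewrite -!catA; apply.
rewrite mem_rcons inE negb_or eq_sym in xp; case/andP: xp => zx xp.
have rE : rcons p z ++ x :: b = p ++ [:: z; x] ++ b by rewrite cat_rcons.
rewrite rE in bal stab *.
have sw := inverted_swappable bal stab xp zx.
apply: (@good_derivable_cons _ _ (a ++ p ++ x :: z :: b)).
  by have := swappable_good_step zx sw; rewrite -!catA.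
suff [bal' stab'] : block_balanced (a ++ p ++ x :: z :: b) (a ++ x :: v) /\
    stable_bad_pairs Sigma (a ++ p ++ x :: z :: b) (a ++ x :: v).
  exact: IHp.
(* Invariance carries the condition from the end of a step back to its start, hence the reversed
   exchange. *)
apply: stable_bad_pairs_swap (conj bal stab); apply: swap_step_sym.
by exists (a ++ p), z, x, b; rewrite -!catA.
Qed.

(** * The semigroup of words modulo exchanges *)

Definition swap_equivb (Sigma : {fset identity}) : rel word :=
  fun u w => `[< swap_equiv Sigma u w >].

Lemma swap_equivb_refl Sigma : reflexive (swap_equivb Sigma).
Proof. by move=> u; apply/asboolP; apply: rt_refl. Qed.

Lemma swap_equivb_sym Sigma : symmetric (swap_equivb Sigma).
Proof. by move=> u w; apply/asboolP/asboolP; apply: swap_equiv_sym. Qed.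

Lemma swap_equivb_trans Sigma : transitive (swap_equivb Sigma).
Proof.
by move=> w u v /asboolP uw /asboolP wv; apply/asboolP; apply: rt_trans uw wv.
Qed.

Definition swap_equiv_rel Sigma : equiv_rel word :=
  EquivRel (swap_equivb Sigma) (@swap_equivb_refl Sigma)
    (@swap_equivb_sym Sigma) (@swap_equivb_trans Sigma).

Definition swap_class (Sigma : {fset identity}) :=
  {eq_quot swap_equiv_rel Sigma}%qT.

Definition word_class Sigma (u : word) : swap_class Sigma :=
  (\pi_(swap_class Sigma) u)%qT.

Lemma word_class_eq Sigma u w :
  word_class Sigma u = word_class Sigma w <-> swap_equiv Sigma u w.
Proof.
split=> [/eqmodP/asboolP // | uw]; apply/eqmodP; exact/asboolP.
Qed.

Lemma repr_word_class Sigma u : swap_equiv Sigma (repr (word_class Sigma u)) u.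
Proof. by apply/word_class_eq; rewrite /word_class reprK. Qed.

Definition mul_class Sigma (A B : swap_class Sigma) : swap_class Sigma :=
  word_class Sigma (repr A ++ repr B).

Lemma mul_word_class Sigma u w :
  mul_class (word_class Sigma u) (word_class Sigma w) =
  word_class Sigma (u ++ w).
Proof.
apply/word_class_eq.
apply: (@rt_trans _ _ _ (repr (word_class Sigma u) ++ w)).
  have := swap_equiv_cat (repr (word_class Sigma u)) [::]
    (repr_word_class Sigma w).
  by rewrite !cats0.
exact: (swap_equiv_cat [::] w (repr_word_class Sigma u)).
Qed.

Lemma mul_classA Sigma : associative (@mul_class Sigma).
Proof.
move=> A B C; rewrite -[A]reprK -[B]reprK -[C]reprK.
by rewrite -!/(word_class _ _) !mul_word_class catA.
Qed.

HB.instance Definition _ (Sigma : {fset identity}) :=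
  SemiGroup.isLaw.Build (swap_class Sigma) (@mul_class Sigma)
    (@mul_classA Sigma).

Lemma eval_word_class Sigma (theta : nat -> word) (u : word) : u != [::] ->
  eval (@mul_class Sigma) (fun x => word_class Sigma (theta x)) u =
  Some (word_class Sigma (subst theta u)).
Proof.
elim: u => // x [|y u] IHu _; first by rewrite /subst /= cats0.
by rewrite eval_cons IHu //; congr Some; apply: mul_word_class.
Qed.

Lemma swap_class_in_variety (Sigma : {fset identity}) :
    (Sigma `<=` [fset sigma_1; sigma_mu; sigma_2])%fset ->
  in_variety (delta_closure Sigma) (@mul_class Sigma).
Proof.
move=> sub e [s sS [X [-> n1 n2]]] phi.
(* Choosing representatives turns any assignment into a substitution, possibly erasing since the
   class of the empty word is an element too. *)
have phiE : phi = fun x => word_class Sigma (repr (phi x)).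
  by apply: funext => x; rewrite /word_class reprK.
rewrite phiE !eval_word_class // !subst_restrict; congr Some.
by apply/word_class_eq; apply: swap_equiv_subst.
Qed.

Lemma variety_satisfies_swap_equiv Sigma u v :
    (Sigma `<=` [fset sigma_1; sigma_mu; sigma_2])%fset ->
    u != [::] -> v != [::] ->
  variety_satisfies (delta_closure Sigma) (u, v) -> swap_equiv Sigma u v.
Proof.
move=> sub u0 v0 sat.
(* Under this assignment every nonempty word evaluates to its own class. *)
have := sat _ _ (swap_class_in_variety sub) (fun x => word_class Sigma [:: x]).
have subst1 w : subst (fun x => [:: x]) w = w.
  by rewrite /subst; elim: w => //= x w ->.
by rewrite /= !eval_word_class // !subst1 => -[/word_class_eq].
Qed.

Local Open Scope fset_scope.

Theorem theorem6p7 (Sigma : {fset identity})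
    (Sigma_sub : Sigma `<=` [fset sigma_1; sigma_mu; sigma_2])
    (Sigma_neq0 : Sigma != fset0)
    (u v : word) (u_neq0 : u != [::]) (v_neq0 : v != [::]) :
  [<-> block_balanced u v /\
         (forall c d : occurrence,
            nonlinear_pair u c d -> bad Sigma u c d -> stable u v c d);
       good_derivable Sigma u v;
       variety_satisfies (delta_closure Sigma) (u, v)].
Proof.
tfae=> [[bal stab] | | sat].
- exact: (@stable_good_derivable Sigma [::]).
- exact: good_derivable_sound.
- apply: (@swap_equiv_stable Sigma u v v).
    exact: variety_satisfies_swap_equiv.
  split=> // c d _ _; rewrite /stable /unstable [X in _ || X]andbC orbb.
  by rewrite /occ_lt; case: ltngtP.
Qed.
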